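(* Let $\mathcal{H}$ be a complex Hilbert space and $T\in\mathcal{B}(\mathcal{H})$. Then: (i) for all real $\alpha,\beta\ge 0$ with $(\alpha,\beta)\ne(0,0)$, $$\|T\|_{\alpha,\beta}^2\le \frac{\alpha}{2}w(T^2)+\left\|\frac{\alpha}{4}(T^*T+TT^* )+\beta T^*T\right\|;$$ (ii) $$w^2(T)\le \inf_{\alpha,\beta}\frac{1}{\alpha+\beta}\left\{\frac{\alpha}{2}w(T^2)+\left\|\frac{\alpha}{4}(T^*T+TT^* )+\beta T^*T\right\|\right\}\le \frac12 w(T^2)+\frac14\|T^*T+TT^*\|,$$ where the infimum is over all real $\alpha,\beta\ge0$ with $(\alpha,\beta)\neq(0,0)$.
   Context: $\mathcal{B}(\mathcal{H})$ is the $C^*$-algebra of bounded linear operators on $\mathcal{H}$. $w(T)=\sup\{|\langle Tx,x\rangle|: \|x\|=1\}$ is the numerical radius, $\|T\|$ the operator norm, and $\|T\|_{\alpha,\beta}=\sup\left\{\sqrt{\alpha|\langle Tx,x\rangle|^2+\beta\|Tx\|^2}: x\in\mathcal{H},\|x\|=1\right\}$. *)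

(* Defs.v *)
From HB Require Import structures.
From mathcomp Require Import all_boot all_order all_algebra.
From mathcomp Require Import complex.
From mathcomp Require Import all_classical all_reals all_analysis.

Set Implicit Arguments.
Unset Strict Implicit.
Unset Printing Implicit Defensive.

Import Order.TTheory GRing.Theory Num.Theory.
Import numFieldNormedType.Exports.

Local Open Scope classical_set_scope.
Local Open Scope complex_scope.
Local Open Scope ring_scope.

(* The inner product is linear in its first argument and conjugate-linear in
   the second; norms of vectors are (real) elements of R[i]. *)
HB.mixin Record isHilbert (R : realType) H
    of CompleteNormedModule R[i] H := {
  inner : {dot H for @Num.conj R[i]} ;
  sqr_norm_inner : forall x : H, `|x| ^+ 2 = inner x x
}.

#[short(type="hilbertType")]
HB.structure Definition Hilbert (R : realType) :=
  {H of CompleteNormedModule R[i] H & isHilbert R H}.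

Notation "''[' x , y ]" := (inner x y)
  (at level 0, format "''[' x ,  y ]") : ring_scope.

Section Operators.
Context {R : realType} {H : hilbertType R}.
Implicit Types (T : H -> H) (x y z : H) (a b : R).

Definition bounded_operator T :=
  linear T /\ exists M : R, forall x, `|T x| <= M%:C * `|x|.

(* For bounded T, the Riesz representation theorem provides exactly one such z
   for every y, so the default value 0 is never used. *)
Definition adjoint T : H -> H :=
  fun y => xget 0 [set z | forall x, '[T x, y] = '[x, z]].

(* For bounded T the real suprema below are those of nonempty sets with an
   upper bound, except when H is the zero space, where sup set0 = 0. *)
Definition unit_sphere : set H := [set x | `|x| = 1].

Definition opnorm T : R := sup [set complex.Re `|T x| | x in unit_sphere].

Definition numerical_radius T : R :=
  sup [set complex.Re `|'[T x, x]| | x in unit_sphere].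

Definition abnorm a b T : R :=
  sup [set Num.sqrt (a * complex.Re `|'[T x, x]| ^+ 2 + b * complex.Re `|T x| ^+ 2)
      | x in unit_sphere].

End Operators.

(* Main.v *)
(* Write T' for the adjoint of T. Buzano's inequality with the vectors Tx, T'x
   and a unit vector x gives
     2 |<Tx,x>|^2 <= |Tx| |T'x| + |<T^2 x,x>|,
   and |Tx| |T'x| <= (|Tx|^2 + |T'x|^2) / 2, while
     a/4 (|Tx|^2 + |T'x|^2) + b |Tx|^2
   is the quadratic form of a/4 (T'T + TT') + b T'T at x. The first bound
   on w(T)^2 follows from |<Tx,x>| <= |Tx|, the second one from (a, b) = (1, 0).
   The adjoint exists by the Riesz representation theorem: a minimizing sequence
   of |x|^2 - 2 Re f(x) is Cauchy by the parallelogram identity, and its limit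
   represents f. *)

Require Import Defs.
From HB Require Import structures.
From mathcomp Require Import all_boot all_order all_algebra.
From mathcomp Require Import complex.
From mathcomp Require Import all_classical all_reals all_analysis.
From mathcomp Require Import ring lra.

Set Implicit Arguments.
Unset Strict Implicit.
Unset Printing Implicit Defensive.

Import Order.TTheory GRing.Theory Num.Theory.
Import numFieldNormedType.Exports.

Local Open Scope classical_set_scope.
Local Open Scope complex_scope.
Local Open Scope ring_scope.

(** * Cauchy-Schwarz and Buzano inequalities *)

Section InnerProduct.
Context {R : realType} {H : hilbertType R}.
Implicit Types (x y z : H) (c : R[i]).

Lemma innerDl x y z : '[x + y, z] = '[x, z] + '[y, z].
Proof. exact: linearDl. Qed.

Lemma innerZl c x y : '[c *: x, y] = c * '[x, y].
Proof. exact: linearZl_LR. Qed.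

Lemma innerBr x y z : '[x, y - z] = '[x, y] - '[x, z].
Proof. exact: linearBr. Qed.

Lemma innerZr c x y : '[x, c *: y] = Num.conj c * '[x, y].
Proof. exact: linearZr_LR. Qed.

Lemma innerC x y : '[x, y] = Num.conj '[y, x].
Proof. by rewrite hermC expr0 mul1r. Qed.

(** The squared norm of <y,y> x - <x,y> y is nonnegative and equals <y,y> (<x,x> <y,y> -
    |<x,y>|^2). *)
Lemma cauchy_schwarz x y : `|'[x, y]| <= `|x| * `|y|.
Proof.
rewrite -ler_sqr ?nnegrE ?mulr_ge0// exprMn !sqr_norm_inner.
have [->|y0] := eqVneq y 0.
  by rewrite !linear0r normr0 expr0n/=.
have := dnorm_ge0 (@inner R H) ('[y, y] *: x - '[x, y] *: y).
rewrite dnormB !dnormZ innerZl innerZr [Num.conj ('[y, y] * _)]rmorphM/=.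
have y_gt0 : 0 < '[y, y] by rewrite dnorm_gt0.
rewrite (ger0_norm (ltW y_gt0)) -[Num.conj '[y, y]]innerC.
rewrite rmorphM/= conjCK normCK -innerC.
set n := '[y, y]; set a := '[x, y]; set b := '[y, x].
have -> : n ^+ 2 * '[x, x] + a * b * n - (n * (b * a) + n * (a * b))
  = n * ('[x, x] * n - a * b) by ring.
by rewrite pmulr_rge0// subr_ge0.
Qed.

(* 2 <y,z> z - y is a reflection of y, so it has the norm of y. *)
Lemma buzano x y z : `|z| = 1 ->
  2 * `|'[x, z] * '[z, y]| <= `|x| * `|y| + `|'[x, y]|.
Proof.
move=> z1.
have refl_norm : `|(2 * '[y, z]) *: z - y| = `|y|.
  apply/eqP; rewrite -(@eqrXn2 _ 2)//; apply/eqP; rewrite !sqr_norm_inner.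
  rewrite dnormB dnormZ innerZl -(sqr_norm_inner z) z1 normrM rmorphM/= -innerC.
  rewrite rmorphM/= conjC_nat exprMn normr_nat normCK -innerC.
  ring.
rewrite -refl_norm.
have -> : 2 * `|'[x, z] * '[z, y]| =
    `|'[x, (2 * '[y, z]) *: z - y] + '[x, y]|.
  rewrite innerBr innerZr subrK rmorphM/= conjC_nat -innerC.
  by rewrite -[in LHS](normr_nat _ 2) -normrM; congr `|_|; ring.
by rewrite (le_trans (ler_normD _ _))// lerD2r cauchy_schwarz.
Qed.

End InnerProduct.

(** * Riesz representation by minimizing a quadratic functional *)

Section Riesz.
Context {R : realType} {H : hilbertType R}.
Variables (f : H -> R[i]) (K : R).
Hypothesis f_scalar : scalar f.
Hypothesis f_bounded : forall x, `|f x| <= K%:C * `|x|.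

Let energy (x : H) : R[i] := `|x| ^+ 2 - (f x + Num.conj (f x)).

Let energy_real x : energy x \is Num.real.
Proof.
rewrite rpredB ?rpredX ?normr_real//.
by rewrite CrealE rmorphD/= conjCK addrC.
Qed.

(** Since 2 Re f(x) <= 2 K |x|, completing the square gives the bound. *)
Let energy_lb x : - (K ^+ 2)%:C <= energy x.
Proof.
have fx : f x + Num.conj (f x) <= 2 * (K%:C * `|x|).
  rewrite (le_trans (real_ler_norm _))//.
    by rewrite CrealE rmorphD/= conjCK addrC.
  rewrite (le_trans (ler_normD _ _))// norm_conjC -mulr2n mulr_natl.
  by rewrite lerMn2r f_bounded orbT.
have : 0 <= (`|x| - K%:C) ^+ 2.
  by rewrite real_exprn_even_ge0// rpredB ?normr_real// complex_real.
rewrite -subr_ge0 => sq_ge0; rewrite -subr_ge0.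
have -> : energy x - - (K ^+ 2)%:C = ((`|x| - K%:C) ^+ 2 - 0) +
   (2 * (K%:C * `|x|) - (f x + Num.conj (f x))).
  by rewrite /energy rmorphXn/=; ring.
by rewrite addr_ge0// subr_ge0.
Qed.

(** The coefficient ['[x, u] - f x] of the linear term is the defect of [u] as a representing
    vector: it has to vanish at a minimizer. *)
Let energy_shift u x c :
  energy (u + c *: x) = energy u + (`|c| ^+ 2 * `|x| ^+ 2
    + (c * ('[x, u] - f x) + Num.conj (c * ('[x, u] - f x)))).
Proof.
rewrite /energy !sqr_norm_inner dnormD dnormZ innerZr innerC.
have -> : f (u + c *: x) = c * f x + f u by rewrite addrC f_scalar.
rewrite !rmorphM !rmorphD !rmorphM/= !rmorphN/= conjCK -!innerC.
ring.
Qed.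

(** On the line from [v] to [u] the energy is a quadratic polynomial; the linear terms cancel in
    this second difference. *)
Let energy_mid u v :
  energy u + energy v - 2 * energy (2^-1 *: (u + v)) = 2^-1 * `|u - v| ^+ 2.
Proof.
have -> : 2^-1 *: (u + v) = v + 2^-1 *: (u - v).
  have half : v = 2^-1 *: v + 2^-1 *: v.
    by rewrite -scalerDl (_ : 2^-1 + 2^-1 = 1) ?scale1r//; field.
  by rewrite scalerBr scalerDr [X in _ = X + _]half addrACA addrN addr0 addrC.
have -> : energy u = energy (v + 1 *: (u - v)) by rewrite scale1r addrC subrK.
rewrite !energy_shift.
rewrite mul1r rmorphM/= fmorphV/= conjC_nat normr1 normfV normr_nat.
by field.
Qed.

Lemma riesz_representation : exists z, forall x, f x = '[x, z].
Proof.
pose E := [set complex.Re (energy x) | x in [set: H]].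
have ReE x : (complex.Re (energy x))%:C = energy x by rewrite RRe_real.
have infE : has_inf E.
  split; first by exists (complex.Re (energy 0)); exists 0.
  exists (- K ^+ 2) => _ [x _ <-].
  by rewrite -lecR ReE rmorphN/= energy_lb.
pose d := inf E.
have d_le x : d <= complex.Re (energy x).
  by apply: ge_inf; [case: infE | exists x].
have /choice[u uE] n : exists x, complex.Re (energy x) < d + n.+1%:R^-1.
  have [|_ [x _ <-] xd] := @inf_adherent _ E n.+1%:R^-1 _ infE.
    by rewrite invr_gt0.
  by exists x.
(* Minimality of d on the line through v directed by x. *)
have near_min v x : `|'[x, v] - f x| ^+ 2 <= (energy v - d%:C) * `|x| ^+ 2.
  have [->|x0] := eqVneq x 0.
    have f0 : f 0 = 0 by rewrite -(addNr x) -scaleN1r f_scalar mulN1r addNr.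
    by rewrite f0 linear0l subrr !normr0 !expr0n/= mulr0.
  set w := '[x, v] - f x.
  have x_gt0 : 0 < `|x| ^+ 2 by rewrite exprn_gt0// normr_gt0.
  (* This coefficient minimizes the quadratic of [energy_shift], lowering the energy of [v] by |w|^2
     / |x|^2. *)
  have := d_le (v + (- (Num.conj w / `|x| ^+ 2)) *: x).
  rewrite -lecR ReE energy_shift -/w mulNr [Num.conj w / _ * w]mulrAC.
  rewrite [Num.conj w * w]mulrC -normCK.
  have -> : Num.conj (- (`|w| ^+ 2 / `|x| ^+ 2)) = - (`|w| ^+ 2 / `|x| ^+ 2).
    by apply/CrealP; rewrite rpredN rpred_div ?rpredX ?normr_real.
  rewrite normrN normrM norm_conjC normfV (ger0_norm (ltW x_gt0)).
  rewrite -ler_pdivrMr// => dE.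
  rewrite lerBrDr addrC -lerBrDr (le_trans dE)// le_eqVlt.
  by apply/orP; left; apply/eqP; field; rewrite normr_eq0.
(* By [energy_mid]: both energies exceed [d] by less than the given reciprocals, and the energy of
   the midpoint is at least [d]. *)
have u_close n m : `|u n - u m| ^+ 2 <= (2 * (n.+1%:R^-1 + m.+1%:R^-1))%:C.
  have -> : `|u n - u m| ^+ 2 = (2 * (complex.Re (energy (u n))
      + complex.Re (energy (u m))
      - 2 * complex.Re (energy (2^-1 *: (u n + u m)))))%:C.
    rewrite !(rmorphM, rmorphB, rmorphD)/= rmorph1 -[1 + 1]/2%:R !ReE.
    by rewrite energy_mid; field.
  have := uE n; have := uE m; have := d_le (2^-1 *: (u n + u m)).
  rewrite lecR; move: (n.+1%:R^-1) (m.+1%:R^-1) => p q; lra.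
have u_cauchy : cauchy (u @ \oo).
  apply: cauchy_exP => eps eps_gt0.
  have epsE : eps = (complex.Re eps)%:C by rewrite RRe_real// gtr0_real.
  have e_gt0 : 0 < complex.Re eps by rewrite -ltcR -epsE.
  (* With both reciprocals below eps^2 / 4, [u_close] bounds the squared distance by eps^2. *)
  have e4_gt0 : 0 < complex.Re eps ^+ 2 / 4 by rewrite divr_gt0// exprn_gt0.
  have [N _ NP] := near_infty_natSinv_lt (PosNum e4_gt0).
  exists (u N); exists N => // n /= Nn.
  rewrite -ball_normE /ball_/= -ltr_sqr ?nnegrE ?(ltW eps_gt0)//.
  rewrite (le_lt_trans (u_close _ _))// epsE -rmorphXn/= ltcR.
  have := NP N (leqnn N); have := NP n Nn; rewrite /=.
  by move: (N.+1%:R^-1) (n.+1%:R^-1) => p q; lra.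
have [z uz] : exists z : H, u @ \oo --> z.
  by exists (lim (u @ \oo) : H); exact: cauchy_cvg.
exists z => x; apply/eqP; rewrite eq_sym -subr_eq0 -normr_eq0.
set w := _ - _.
(* One [e] bounds |z - u n|; the other comes from [near_min] once the energy of [u n] is within e^2
   of [d]. *)
have small e : 0 < e -> `|w| <= (2 * e)%:C * `|x|.
  move=> e_gt0.
  have e2_gt0 : 0 < e ^+ 2 by rewrite exprn_gt0.
  have eC_gt0 : 0 < e%:C by rewrite ltcR.
  near \oo => n.
  have -> : w = '[x, z - u n] + ('[x, u n] - f x).
    by rewrite innerBr addrA subrK.
  rewrite (le_trans (ler_normD _ _))// mulrDl mul1r rmorphD/= mulrDl.
  apply: lerD.
    rewrite (le_trans (cauchy_schwarz _ _))// mulrC ler_wpM2r//.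
    near: n; move/cvgrPdist_le : uz; exact.
  rewrite -ler_sqr ?nnegrE ?mulr_ge0 ?(ltW eC_gt0)//.
  rewrite (le_trans (near_min _ _))//.
  rewrite exprMn ler_wpM2r ?exprn_ge0// -ReE -rmorphB -rmorphXn/= lecR lerBlDl.
  rewrite (le_trans (ltW (uE n)))// lerD2l ltW//.
  near: n; exact: (near_infty_natSinv_lt (PosNum e2_gt0)).
have wE : `|w| = (complex.Re `|w|)%:C by rewrite RRe_real.
have xE : `|x| = (complex.Re `|x|)%:C by rewrite RRe_real.
have x_ge0 : 0 <= complex.Re `|x| by rewrite -ler0c -xE.
have w_ge0 : 0 <= complex.Re `|w| by rewrite -ler0c -wE.
rewrite wE; move: small; rewrite wE xE => small.
rewrite -(rmorph0 (real_complex R)) (inj_eq (@complexI R)) eq_le w_ge0 andbT.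
apply/ler_addgt0Pr => e e_gt0; rewrite add0r.
set X := complex.Re `|x| in x_ge0 small *.
(* Dividing by X + 1 instead of X also covers X = 0 and still leaves e X / (X + 1) <= e. *)
have X1_gt0 : 0 < X + 1 by lra.
have := small _ (divr_gt0 e_gt0 (mulr_gt0 (ltr0Sn _ 1) X1_gt0)).
rewrite -rmorphM/= lecR => /le_trans; apply.
have -> : 2 * (e / (2 * (X + 1))) * X = e * X / (X + 1).
  by field; rewrite gt_eqF.
rewrite ler_pdivrMr// ler_wpM2l ?ltW//; lra.
Unshelve. all: end_near.
Qed.

End Riesz.

(** * Bounds on suprema, valid also for the default value 0 *)

Section RealSup.
Context {R : realType}.
Implicit Types (A : set R) (s : R).

Lemma sup_ge0 A : (forall v, A v -> 0 <= v) -> 0 <= sup A.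
Proof.
move=> A_ge0; have [supA|/sup_out->//] := pselect (has_sup A).
have [[v Av] ubA] := supA.
by rewrite (le_trans (A_ge0 _ Av))// ub_le_sup.
Qed.

Lemma sup_le A s : 0 <= s -> ubound A s -> sup A <= s.
Proof.
have [->|/set0P A0] := eqVneq A set0; first by rewrite sup0.
by move=> _; exact: ge_sup.
Qed.

(** Each element is at most the square root of [s], hence so is the supremum, which is
    nonnegative. *)
Lemma sqr_sup_le A s : 0 <= s ->
  (forall v, A v -> 0 <= v /\ v ^+ 2 <= s) -> sup A ^+ 2 <= s.
Proof.
move=> s_ge0 A_le; rewrite -[leRHS]sqr_sqrtr// ler_sqr ?nnegrE ?sqrtr_ge0//.
  apply: sup_le => [|v /A_le[v_ge0 v_le]]; first exact: sqrtr_ge0.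
  by rewrite -ler_sqr ?nnegrE ?sqrtr_ge0// sqr_sqrtr.
by apply: sup_ge0 => v /A_le[].
Qed.

End RealSup.

(** * Adjoints, operator norms and pointwise estimates on the unit sphere *)

Section BoundedMaps.
Context {R : realType} {H : hilbertType R}.
Implicit Types (S T : H -> H) (x y : H) (a b c : R).

Lemma ReNormE (V : normedZmodType R[i]) (v : V) : (complex.Re `|v|)%:C = `|v|.
Proof. by rewrite RRe_real. Qed.

Lemma ReNorm_ge0 (V : normedZmodType R[i]) (v : V) : 0 <= complex.Re `|v|.
Proof. by rewrite -ler0c ReNormE. Qed.

(** The boundedness half of [bounded_operator]: it makes the suprema genuine upper bounds and passes
    directly to [adjoint T], sums and compositions. *)
Definition norm_bounded S := exists M : R, forall x, `|S x| <= M%:C * `|x|.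

Lemma norm_bounded_comp S T :
  norm_bounded S -> norm_bounded T -> norm_bounded (S \o T).
Proof.
(* [M] may be negative on the zero space, and monotonicity of the product calls for a nonnegative
   factor. *)
move=> [M SM] [N TN]; exists (Num.max 0 M * N) => x /=.
have M_ge0 : 0 <= (Num.max 0 M)%:C by rewrite ler0c le_max lexx.
rewrite (le_trans (SM _))// (@le_trans _ _ ((Num.max 0 M)%:C * `|T x|))//.
  by rewrite ler_wpM2r// lecR le_max lexx orbT.
by rewrite rmorphM/= -mulrA ler_wpM2l.
Qed.

Lemma norm_bounded_add S T :
  norm_bounded S -> norm_bounded T -> norm_bounded (S + T).
Proof.
move=> [M SM] [N TN]; exists (M + N) => x.
by rewrite (le_trans (ler_normD _ _))// rmorphD mulrDl lerD.
Qed.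

Lemma norm_bounded_scale c S : norm_bounded S -> norm_bounded (c%:C *: S).
Proof.
move=> [M SM]; exists (`|c| * M) => x.
have -> : `|(c%:C *: S) x| = `|c|%:C * `|S x|.
  by rewrite normrZ normc_def/= expr0n addr0 sqrtr_sqr.
by rewrite rmorphM/= -mulrA ler_wpM2l// ler0c.
Qed.

Lemma opnorm_ge S x : norm_bounded S -> `|x| = 1 ->
  complex.Re `|S x| <= opnorm S.
Proof.
move=> [M SM] x1; apply: ub_le_sup; last by exists x.
by exists M => _ [y y1 <-]; rewrite -lecR ReNormE (le_trans (SM y))// y1 mulr1.
Qed.

Lemma numerical_radius_ge S x : norm_bounded S -> `|x| = 1 ->
  complex.Re `|'[S x, x]| <= numerical_radius S.
Proof.
move=> [M SM] x1; apply: ub_le_sup; last by exists x.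
exists M => _ [y y1 <-]; rewrite -lecR ReNormE.
by rewrite (le_trans (cauchy_schwarz _ _))// y1 mulr1 (le_trans (SM y))// y1 mulr1.
Qed.

Lemma opnorm_ge0 S : 0 <= opnorm S.
Proof. by apply: sup_ge0 => _ [x _ <-]; exact: ReNorm_ge0. Qed.

Lemma numerical_radius_ge0 S : 0 <= numerical_radius S.
Proof. by apply: sup_ge0 => _ [x _ <-]; exact: ReNorm_ge0. Qed.

Lemma opnormZ_le c S : 0 <= c -> norm_bounded S ->
  opnorm (c%:C *: S) <= c * opnorm S.
Proof.
move=> c_ge0 S_bd; apply: sup_le => [|_ [x x1 <-]].
  by rewrite mulr_ge0// opnorm_ge0.
rewrite [X in `|X|]/(_ *: S x) normrZ ger0_norm ?ler0c// -ReNormE -rmorphM/=.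
by rewrite ler_wpM2l// opnorm_ge.
Qed.

(** Riesz for the functional sending u to <Tu,y>, bounded by M |y|, shows that the set in [adjoint]
    is inhabited. *)
Lemma adjointE T x y : bounded_operator T -> '[T x, y] = '[x, adjoint T y].
Proof.
move=> [T_lin [M TM]].
apply: (@xgetPex _ 0 [set z | forall x, '[T x, y] = '[x, z]]).
apply: (@riesz_representation _ _ _ (M * complex.Re `|y|)) => [c u v|u].
  by rewrite T_lin innerDl innerZl.
rewrite (le_trans (cauchy_schwarz _ _))// rmorphM/= ReNormE mulrAC.
by rewrite ler_wpM2r.
Qed.

(** With T' the adjoint, |T'y|^2 = <TT'y,y> <= M |T'y| |y|; a nonzero |T'y| cancels. *)
Lemma adjoint_norm_bounded T : bounded_operator T -> norm_bounded (adjoint T).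
Proof.
move=> T_bd; have [_ [M TM]] := T_bd; exists M => y.
have My_ge0 : 0 <= M%:C * `|y| by rewrite (le_trans _ (TM y)).
have [->//|] := eqVneq `|adjoint T y| 0.
rewrite -normr_gt0 normr_id => Ty_gt0.
rewrite -(ler_pM2r Ty_gt0) -expr2 -[leLHS]ger0_norm ?exprn_ge0//.
rewrite sqr_norm_inner -adjointE// (le_trans (cauchy_schwarz _ _))//.
by rewrite mulrAC ler_wpM2r.
Qed.

Lemma inner_adjoint_comp T x : bounded_operator T ->
  '[(adjoint T \o T) x, x] = `|T x| ^+ 2.
Proof.
by move=> T_bd; rewrite /= innerC -adjointE// sqr_norm_inner -innerC.
Qed.

Lemma inner_comp_adjoint T x : bounded_operator T ->
  '[(T \o adjoint T) x, x] = `|adjoint T x| ^+ 2.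
Proof. by move=> T_bd; rewrite /= adjointE// sqr_norm_inner. Qed.

Definition weighted_modulus a b T : H -> H :=
  (a / 4)%:C *: ((adjoint T \o T) + (T \o adjoint T))
  + b%:C *: (adjoint T \o T).

Lemma weighted_modulus_bounded a b T : bounded_operator T ->
  norm_bounded (weighted_modulus a b T).
Proof.
move=> T_bd; have [_ Tb] := T_bd; have T'b := adjoint_norm_bounded T_bd.
by apply: norm_bounded_add; apply: norm_bounded_scale;
  first apply: norm_bounded_add; apply: norm_bounded_comp.
Qed.

(** The left side is the quadratic form of [weighted_modulus a b T] at [x], to which Cauchy-Schwarz
    applies. *)
Lemma weighted_modulus_opnorm_ge a b T x : bounded_operator T -> `|x| = 1 ->
  a / 4 * (complex.Re `|T x| ^+ 2 + complex.Re `|adjoint T x| ^+ 2)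
    + b * complex.Re `|T x| ^+ 2 <= opnorm (weighted_modulus a b T).
Proof.
move=> T_bd x1.
rewrite (le_trans _ (opnorm_ge (weighted_modulus_bounded a b T_bd) x1))//.
rewrite -lecR ReNormE -[leRHS]mulr1 -x1 (le_trans _ (cauchy_schwarz _ _))//.
rewrite -[X in '[X, _]]/((a / 4)%:C *: ((adjoint T \o T) x + (T \o adjoint T) x)
   + b%:C *: (adjoint T \o T) x).
rewrite innerDl !innerZl innerDl inner_adjoint_comp// inner_comp_adjoint//.
rewrite -[`|T x|]ReNormE -[`|adjoint T x|]ReNormE.
by rewrite -!rmorphXn -rmorphD -!rmorphM -rmorphD/= real_ler_norm ?complex_real.
Qed.

Lemma weighted_radius_le a b T x : bounded_operator T -> 0 <= a -> `|x| = 1 ->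
  a * complex.Re `|'[T x, x]| ^+ 2 + b * complex.Re `|T x| ^+ 2
    <= a / 2 * numerical_radius (T \o T) + opnorm (weighted_modulus a b T).
Proof.
move=> T_bd a_ge0 x1; have [_ Tb] := T_bd.
have := weighted_modulus_opnorm_ge a b T_bd x1.
have := numerical_radius_ge (norm_bounded_comp Tb Tb) x1.
have : 2 * complex.Re `|'[T x, x]| ^+ 2 <=
    complex.Re `|T x| * complex.Re `|adjoint T x| + complex.Re `|'[T (T x), x]|.
  rewrite -lecR rmorphD !rmorphM/= rmorph_nat !ReNormE.
  by have := buzano (T x) (adjoint T x) x1; rewrite -!adjointE// normrM.
rewrite /comp.
move: (complex.Re `|'[T x, x]|) (complex.Re `|T x|) (complex.Re `|adjoint T x|).
move: (complex.Re `|'[T (T x), x]|) (opnorm _) (numerical_radius _).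
move=> s O W p q r bz sW O_ge.
(* This yields a q r <= a (q^2 + r^2) / 2, with q = |Tx| and r = |T'x|; the rest is [bz] and [sW]
   multiplied by a / 2. *)
have : 0 <= a * (q - r) ^+ 2 by rewrite mulr_ge0// sqr_ge0.
nra.
Qed.

Lemma abnorm_sqr_le a b T : bounded_operator T -> 0 <= a -> 0 <= b ->
  abnorm a b T ^+ 2
    <= a / 2 * numerical_radius (T \o T) + opnorm (weighted_modulus a b T).
Proof.
move=> T_bd a_ge0 b_ge0; apply: sqr_sup_le => [|_ [x x1 <-]].
  by rewrite addr_ge0 ?opnorm_ge0// mulr_ge0 ?numerical_radius_ge0// divr_ge0.
split; first exact: sqrtr_ge0.
rewrite sqr_sqrtr ?weighted_radius_le//.
by rewrite addr_ge0// mulr_ge0// exprn_ge0// ReNorm_ge0.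
Qed.

Lemma numerical_radius_sqr_le a b T : bounded_operator T ->
  0 <= a -> 0 <= b -> (a, b) <> (0, 0) ->
  numerical_radius T ^+ 2 <= (a + b)^-1 *
    (a / 2 * numerical_radius (T \o T) + opnorm (weighted_modulus a b T)).
Proof.
move=> T_bd a_ge0 b_ge0 ab0.
have ab_gt0 : 0 < a + b.
  rewrite lt_def addr_ge0// andbT paddr_eq0//.
  by apply/negP => /andP[/eqP a0 /eqP b0]; apply: ab0; rewrite a0 b0.
apply: sqr_sup_le => [|_ [x x1 <-]].
  rewrite mulr_ge0 ?invr_ge0 ?(ltW ab_gt0)// addr_ge0 ?opnorm_ge0//.
  by rewrite mulr_ge0 ?numerical_radius_ge0// divr_ge0.
split; first exact: ReNorm_ge0.
rewrite ler_pdivlMl// (le_trans _ (weighted_radius_le b T_bd a_ge0 x1))//.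
(* The [a] terms agree; for the [b] terms, |<Tx,x>| <= |Tx| on the unit sphere. *)
rewrite mulrDl lerD2l ler_wpM2l// ler_sqr ?nnegrE ?ReNorm_ge0//.
by rewrite -lecR !ReNormE (le_trans (cauchy_schwarz _ _))// x1 mulr1.
Qed.

End BoundedMaps.

(** * The norm bound and the infimum over the weights *)

Theorem theorem2p29 (R : realType) (H : hilbertType R) (T : H -> H)
    (T_bounded : bounded_operator T) :
  (forall a b : R, 0 <= a -> 0 <= b -> (a, b) <> (0, 0) ->
     abnorm a b T ^+ 2
     <= a / 2 * numerical_radius (T \o T)
        + opnorm ((a / 4)%:C *: ((adjoint T \o T) + (T \o adjoint T))
                  + b%:C *: (adjoint T \o T)))
  /\
  (numerical_radius T ^+ 2
   <= inf [set (p.1 + p.2)^-1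
               * (p.1 / 2 * numerical_radius (T \o T)
                  + opnorm ((p.1 / 4)%:C *: ((adjoint T \o T) + (T \o adjoint T))
                            + p.2%:C *: (adjoint T \o T)))
          | p in [set p : R * R | [/\ 0 <= p.1, 0 <= p.2 & p <> (0, 0)]]]
   <= 1 / 2 * numerical_radius (T \o T)
      + 1 / 4 * opnorm ((adjoint T \o T) + (T \o adjoint T))).
Proof.
split=> [a b a_ge0 b_ge0 _|]; first exact: abnorm_sqr_le.
set E := [set _ | _ in _].
have E_ge : lbound E (numerical_radius T ^+ 2).
  by move=> _ [[a b]/= [a_ge0 b_ge0 ab0] <-]; exact: numerical_radius_sqr_le.
have p10 : ((1, 0) : R * R) <> (0, 0) by case=> /eqP; rewrite oner_eq0.
apply/andP; split.
  (* A lower bound passes to [inf] only for a nonempty set, so a pair of weights is exhibited. *)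
  by apply: lb_le_inf => //; eexists; exists (1, 0) => //=; split.
have T_nb := T_bounded.2; have T'_nb := adjoint_norm_bounded T_bounded.
apply: (@le_trans _ _ (1 / 2 * numerical_radius (T \o T)
    + opnorm (weighted_modulus 1 0 T))).
  apply: ge_inf; first by exists (numerical_radius T ^+ 2).
  by exists (1, 0) => /=; [split | rewrite addr0 invr1 mul1r].
rewrite lerD2l /weighted_modulus rmorph0 scale0r addr0 opnormZ_le//.
by apply: norm_bounded_add; exact: norm_bounded_comp.
Qed.
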